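(* Let $a<b$ and $A,B$ be real numbers. Assume that $L:\mathbb{R}\times\mathbb{R}\to[0,+\infty)$, $(y,v)\mapsto L(y,v)$, is of class $C^1$ and that $v\mapsto L(y,v)$ is convex for every $y\in\mathbb{R}$. For $y\in \mathrm{AC}([a,b])$ set $F(y)=\int_a^b L(y(t),y'(t))\,dt\in[0,+\infty]$. Then the Lavrentiev phenomenon does not occur for the problem of minimizing $F(y)$ among $y\in\mathrm{AC}([a,b])$ with $y(a)=A$, $y(b)=B$; that is, $$\inf\{F(y): y\in \mathrm{AC}([a,b]),\ y(a)=A,\ y(b)=B\}=\inf\{F(y): y:[a,b]\to\mathbb{R}\ \text{Lipschitz},\ y(a)=A,\ y(b)=B\}.$$
   Context: $\mathrm{AC}([a,b])$ denotes the space of absolutely continuous functions $y:[a,b]\to\mathbb{R}$, i.e. those for which there is a Lebesgue integrable $f$ on $[a,b]$ with $y(t)=y(a)+\int_a^t f(s)\,ds$ for all $t\in[a,b]$; then $y'=f$ almost everywhere. Lipschitz functions on $[a,b]$ belong to $\mathrm{AC}([a,b])$. Non-occurrence of the Lavrentiev phenomenon means that there is a sequence of Lipschitz functions $y_n$ on $[a,b]$ satisfying $y_n(a)=A$, $y_n(b)=B$ such that $F(y_n)$ converges to the infimum of $F$ over all absolutely continuous functions satisfying these boundary conditions (equivalently, the two infima in the claim coincide). *)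

(* Defs.v *)
From HB Require Import structures.
From mathcomp Require Import all_boot all_order all_algebra.
From mathcomp Require Import all_classical all_reals all_analysis.
Set Implicit Arguments.
Unset Strict Implicit.
Unset Printing Implicit Defensive.
Import Order.TTheory GRing.Theory Num.Theory.
Import numFieldNormedType.Exports.
Local Open Scope classical_set_scope.
Local Open Scope ring_scope.

(* Continuity of p |-> 'd L p is required pointwise, i.e. of p |-> 'd L p h for
   each h; since the domain is finite-dimensional this is the same as
   continuity in operator norm, or of the two partial derivatives. *)
Definition classC1 (R : realType) (L : R * R -> R) : Prop :=
  (forall p, differentiable L p) /\
  (forall h, continuous (fun p => 'd L p h)).

(* A function on [a, b] is represented by a total function R -> R; none of the
   notions below depends on its values outside [a, b]. *)
Definition abs_cont (R : realType) (a b : R) : set (R -> R) :=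
  [set y | exists f : R -> R,
      (@lebesgue_measure R).-integrable `[a, b] (EFin \o f) /\
      forall t, t \in `[a, b] ->
        y t = y a + \int[@lebesgue_measure R]_(s in `[a, t]) f s].

Definition lipschitz_fun (R : realType) (a b : R) : set (R -> R) :=
  [set y | [lipschitz y t | t in `[a, b]]].

Definition boundary (R : realType) (a b A B : R) : set (R -> R) :=
  [set y | y a = A /\ y b = B].

(* [y^`()] is a total function whose value is a junk one where y is not
   differentiable. For y in AC([a, b]), this only concerns a null subset of
   [a, b] (and possibly the endpoints), on which the integral does not
   depend. *)
Definition action (R : realType) (L : R * R -> R) (a b : R) (y : R -> R) :
    \bar R :=
  (\int[@lebesgue_measure R]_(t in `[a, b]) (L (y t, (y^`())%classic t))%:E)%E.

(* Main.v *)
Require Import Defs.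
From HB Require Import structures.
From mathcomp Require Import all_boot all_order all_algebra.
From mathcomp Require Import all_classical all_reals all_analysis.
From mathcomp Require Import measurable_realfun ring lra.
Import Order.TTheory GRing.Theory Num.Theory.
Import numFieldNormedType.Exports.
Set Implicit Arguments.
Unset Strict Implicit.
Unset Printing Implicit Defensive.
Local Open Scope classical_set_scope.
Local Open Scope ring_scope.

(** Let [y] have density [f].  For large [k] take the speed
    [m = 1 + (|f|/k - 1)^+ - d chi], where [chi] is a cutoff supported in
    [|f| <= c] for a fixed [c] and [d] is chosen so that [m] has integral [b - a].
    Then [psi t = a + \int_a^t m] maps [[a, b]] onto itself, and the time change
    [z = y \o psi^-1] is Lipschitz because its derivative is [f / m], bounded by
    [2 k], along [psi^-1].  Its action is [\int m L(y, f / m)], which by convexity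
    exceeds [\int L(y, f)] by at most a multiple of [\int |m - 1|], with a factor
    that only depends on bounds of [L] on [|v| <= 2 c]; this integral tends to
    [0] as [k] grows. *)

(** * Integrals of nonnegative functions that agree off a null set *)

Section integral_eq_off_null.
Import HBNNSimple.

(* The library's [ge0_ae_eq_integral] requires measurability, which is not
   available for the total derivative [y^`()]. *)
Lemma ge0_integral_eq_off_null d (T : measurableType d) (R : realType)
    (mu : {measure set T -> \bar R}) (D N : set T) (f g : T -> \bar R) :
  measurable N -> mu N = 0%E ->
  (forall x, D x -> 0 <= f x)%E -> (forall x, D x -> 0 <= g x)%E ->
  (forall x, D x -> ~ N x -> f x = g x) ->
  (\int[mu]_(x in D) f x = \int[mu]_(x in D) g x)%E.
Proof.
move=> mN N0.
have le_int (f1 f2 : T -> \bar R) : (forall x, D x -> 0 <= f1 x)%E ->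
    (forall x, D x -> 0 <= f2 x)%E ->
    (forall x, D x -> ~ N x -> f1 x = f2 x) ->
    (\int[mu]_(x in D) f1 x <= \int[mu]_(x in D) f2 x)%E.
  move=> f1_ge0 f2_ge0 f12.
  rewrite !ge0_integralE//; apply: ge_ereal_sup => _ [h hf <-].
  (* The integral is a supremum over simple functions below the integrand. Setting such an [h] to
     zero on [N] keeps its integral and turns a competitor for [f1] into one for [f2]. *)
  pose h' : {nnsfun T >-> R} := proj_nnsfun h (measurableC mN).
  have h'0 x : N x -> h' x = 0.
    by move=> Nx; rewrite /h' -mrestrict patchE memNset//= => /(_ Nx).
  have h'E x : ~ N x -> h' x = h x.
    by move=> Nx; rewrite /h' -mrestrict patchE mem_set.
  apply: le_ereal_sup_tmp; exists (sintegral mu h').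
    exists h' => // x.
    have [Nx|Nx] := pselect (N x).
      rewrite h'0//; rewrite patchE; case: ifPn => // /set_mem; exact: f2_ge0.
    rewrite h'E//; apply: le_trans (hf x) _.
    by rewrite !patchE; case: ifPn => // /set_mem Dx; rewrite f12.
  rewrite -!integralT_nnsfun.
  rewrite (@ge0_ae_eq_integral _ _ _ mu setT (EFin \o h) (EFin \o h'))//.
  - by apply/measurable_EFinP.
  - by apply/measurable_EFinP.
  - by move=> x _; rewrite lee_fin.
  - by move=> x _; rewrite lee_fin.
  - exists N; split => // x /= hh; apply: contrapT => Nx; apply: hh => _.
    by congr EFin; rewrite [RHS](h'E x Nx).
move=> f0 g0 fg; apply/eqP; rewrite eq_le; apply/andP; split; apply: le_int => //.
by move=> x Dx Nx; rewrite fg.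
Qed.

End integral_eq_off_null.

(** * The action expressed through a density *)

Section action_of_density.
Context {R : realType}.
Notation mu := (@lebesgue_measure R).
Implicit Types (a b t : R) (f y : R -> R).

(** The fundamental theorem of calculus at Lebesgue points of [f] extended by zero; [N] is the null
    set of the other points. The derivative is two-sided and [y] is a primitive only on [[a, b]], so
    the endpoints are left out. *)
Lemma derive_primitive_ae a b f y :
  mu.-integrable `[a, b] (EFin \o f) ->
  (forall t, t \in `[a, b] -> y t = y a + \int[mu]_(s in `[a, t]) f s) ->
  exists N : set R, [/\ measurable N, mu N = 0%E &
    forall t, t \in `]a, b[ -> ~ N t -> (y^`())%classic t = f t].
Proof.
move=> intf yE.
pose fD := f \_ `[a, b].
have locf : locally_integrable [set: R] fD by exact: integrable_locally.
have [N [mN N0 subN]] := lebesgue_differentiation locf.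
exists N; split => // t tab Nt.
have [at_ tb] : a < t /\ t < b by move: tab; rewrite in_itv => /andP[].
have pt : lebesgue_pt fD t by apply: contrapT => h; apply: Nt; exact: subN.
have intfD : mu.-integrable `[a, b] (EFin \o fD).
  apply: eq_integrable intf => // x xab; rewrite /= /fD patchE ifT//.
have at' : (BLeft a < BRight t)%E by rewrite /= lte_fin.
have [dF F'] := FTC1_lebesgue_pt tb intfD at' pt.
set F := fun _ => _ in dF F'.
have -> : f t = F^`()%classic t.
  by rewrite F' /fD patchE ifT// inE/= in_itv/= !ltW.
rewrite !derive1E.
have -> : 'D_1 F t = 'D_1 (cst (y a) + F) t.
  by rewrite deriveD// derive_cst add0r.
apply: near_eq_derive.
near=> x; rewrite yE; last first.
  rewrite in_itv/=; apply/andP; split; apply/ltW; near: x.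
    exact: lt_nbhsr.
  exact: lt_nbhsl.
have xb : x < b by near: x; exact: lt_nbhsl.
rewrite fctE /cst; congr (_ + _); apply: eq_Rintegral => s.
rewrite inE/= in_itv/= => /andP[as_ sx]; rewrite /fD patchE ifT// inE/= in_itv/=.
by rewrite as_/= (le_trans sx)// ltW.
Unshelve. all: by end_near. Qed.

Lemma action_density (L : R * R -> R) a b f y : a < b ->
  (forall p, 0 <= L p) ->
  mu.-integrable `[a, b] (EFin \o f) ->
  (forall t, t \in `[a, b] -> y t = y a + \int[mu]_(s in `[a, t]) f s) ->
  action L a b y = (\int[mu]_(t in `[a, b]) (L (y t, f t))%:E)%E.
Proof.
move=> ab L0 intf yE.
have [N [mN N0 subN]] := derive_primitive_ae intf yE.
rewrite /action.
(* The endpoints join the null set: there the derivative depends on values of [y] outside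
   [[a, b]]. *)
apply: (@ge0_integral_eq_off_null _ _ _ mu _ (N `|` ([set a] `|` [set b]))).
- by apply: measurableU => //; apply: measurableU.
- apply: null_set_setU => //; first exact: measurableU.
  by apply: null_set_setU => //; exact: lebesgue_measure_set1.
- by move=> t _; rewrite lee_fin.
- by move=> t _; rewrite lee_fin.
move=> t /=; rewrite in_itv/= => /andP[at_ tb] /not_orP[Nt /not_orP[ta tb']].
rewrite subN// in_itv/=; apply/andP; split; rewrite lt_neqAle.
  by rewrite at_ andbT; apply/eqP => e; apply: ta.
by rewrite tb andbT; apply/eqP => e; apply: tb'.
Qed.

End action_of_density.

(** * Lipschitz functions are absolutely continuous *)

Section lipschitz_density.
Context {R : realType}.
Notation mu := (@lebesgue_measure R).

Lemma lebesgue_measure_segment (a b : R) : a <= b ->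
  mu `[a, b]%classic = (b - a)%:E.
Proof.
rewrite lebesgue_measure_itv/= lte_fin le_eqVlt => /predU1P[->|->//].
by rewrite ltxx subrr.
Qed.

Lemma lebesgue_measure_segment_ltey (a b : R) : (mu `[a, b]%classic < +oo)%E.
Proof.
by rewrite lebesgue_measure_itv/=; case: ifP => // _; rewrite -EFinB ltry.
Qed.

Lemma bounded_segment_integrable (a b M : R) (f : R -> R) :
  measurable_fun `[a, b] f -> (forall x, x \in `[a, b] -> `|f x| <= M) ->
  mu.-integrable `[a, b] (EFin \o f).
Proof.
move=> mf fM; apply: measurable_bounded_integrable => //.
  exact: lebesgue_measure_segment_ltey.
exists M; split; first exact: num_real.
by move=> N MN x xab; apply: le_trans (fM _ xab) _; exact: ltW.
Qed.

Lemma nonexpansive_continuous (g : R -> R) :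
  (forall s t, `|g s - g t| <= `|s - t|) -> continuous g.
Proof.
move=> g1 x; apply/cvgrPdist_le => e e0.
near=> t; apply: le_trans (g1 _ _) _.
by near: t; apply: (@cvgr_dist_le _ R); [exact: cvg_id|].
Unshelve. all: by end_near. Qed.

Lemma lebesgue_stieltjes_measure_ocitv (g : cumulative R R) (s t : R) : s <= t ->
  lebesgue_stieltjes_measure g `]s, t]%classic = (g t - g s)%:E.
Proof.
move=> st; rewrite /lebesgue_stieltjes_measure /measure_extension/=.
by rewrite measurable_mu_extE/= ?wlength_itv_bnd//; exact: is_ocitv.
Qed.

(** Both [g] and [h t = t - g t] are nondecreasing and continuous, and their Stieltjes measures add
    up to Lebesgue measure, as is seen on half-open intervals. So the measure of [g] is dominated by
    Lebesgue measure, and its Radon-Nikodym derivative is the density. *)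
Lemma nonexpansive_density (a b : R) (g : R -> R) : a <= b ->
  (forall s t, s <= t -> 0 <= g t - g s <= t - s) ->
  exists2 w : R -> R, mu.-integrable `[a, b] (EFin \o w) &
    forall t, t \in `[a, b] -> g t - g a = \int[mu]_(s in `[a, t]) w s.
Proof.
move=> ab g1.
have nd_g : {homo g : s t / s <= t}.
  by move=> s t /g1 /andP[]; rewrite subr_ge0.
have g_lip s t : `|g s - g t| <= `|s - t|.
  wlog st : s t / s <= t.
    move=> h; have [/h//|/ltW /h] := leP s t.
    by rewrite distrC (distrC t).
  have /andP[h0 h1] := g1 _ _ st.
  by rewrite distrC (distrC s) !ger0_norm// subr_ge0.
have g_cont := nonexpansive_continuous g_lip.
pose h := fun t => t - g t.
have nd_h : {homo h : s t / s <= t}.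
  by move=> s t /g1 /andP[_]; rewrite /h; lra.
have h_cont : continuous h.
  by move=> t; apply: cvgB; [exact: cvg_id|exact: g_cont].
pose G : cumulative R R := HB.pack g
  (isCumulative.Build R _ R g nd_g (right_continuousW g_cont)).
pose H : cumulative R R := HB.pack h
  (isCumulative.Build R _ R h nd_h (right_continuousW h_cont)).
pose LG : {measure set (measurableTypeR R) -> \bar R} := lebesgue_stieltjes_measure G.
pose LH : {measure set (measurableTypeR R) -> \bar R} := lebesgue_stieltjes_measure H.
have GH A : measurable A -> mu A = (LG A + LH A)%E.
  move=> mA; rewrite -(measure_addE LG LH).
  apply: (@lebesgue_measure_unique R (measure_add LG LH)) => // X [[s t] _ <-].
  rewrite [RHS]measure_addE.
  have [st|st] := leP s t; last first.
    by rewrite set_itv_ge ?measure0 ?adde0// bnd_simp -leNgt ltW.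
  transitivity ((g t - g s)%:E + (h t - h s)%:E)%E; last first.
    congr (_ + _)%E; apply/esym.
      exact: (lebesgue_stieltjes_measure_ocitv G st).
    exact: (lebesgue_stieltjes_measure_ocitv H st).
  rewrite -EFinD /h addrACA -opprD !subrKC.
  exact: (lebesgue_stieltjes_measure_ocitv idfun st).
have mD : measurable (`[a, b]%classic : set (measurableTypeR R)) by exact: measurable_itv.
have GD : (LG `[a, b]%classic < +oo)%E.
  apply: (@le_lt_trans _ _ (mu `[a, b]%classic)).
    by rewrite GH// leeDl.
  exact: lebesgue_measure_segment_ltey.
pose nu : {finite_measure set (measurableTypeR R) -> \bar R} := mfrestr mD GD.
have numu : nu `<< mu.
  apply/null_content_dominatesP => A mA A0.
  apply/eqP; rewrite eq_le measure_ge0 andbT -A0 [leRHS](GH A mA).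
  apply: le_trans (leeDl _ _) => //.
  by apply: le_measure; rewrite ?inE//; exact: measurableI.
have [w [w0 wfin wint wE]] := radon_nikodym_sigma_finite numu.
exists (fine \o w).
  apply: (@integrableS _ _ _ mu setT) => //.
  apply: eq_integrable wint => // x _ /=; rewrite fineK//.
move=> t; rewrite in_itv/= => /andP[at_ tb].
(* On []a, t]] the Stieltjes measure of [g] is [g t - g a], so the left endpoint is dropped
   first. *)
rewrite -Rintegral_itv_obnd_cbnd; last first.
  apply: (@integrableS _ _ _ mu setT) => //.
  apply: eq_integrable wint => // x _ /=; rewrite fineK//.
rewrite /Rintegral.
under eq_integral do rewrite /= fineK//.
rewrite -wE//= /nu /mfrestr /mrestr setIidl; last first.
  by apply: subset_itv; rewrite ?bnd_simp.
by rewrite lebesgue_stieltjes_measure_ocitv.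
Qed.

(** Once scaled to Lipschitz constant 1, [y] becomes nondecreasing by adding the identity; halving
    the sum brings its slopes into [[0, 1]], where [nonexpansive_density] applies. *)
Lemma lipschitz_abs_cont (a b : R) (y : R -> R) : a < b ->
  lipschitz_fun a b y -> abs_cont a b y.
Proof.
move=> ab [M [Mreal Mlip]].
(* The Lipschitz bound holds for all constants strictly above [M], which may be negative; [K] is
   such a constant and is positive. *)
pose K := Num.max M 0 + 1.
have K0 : 0 < K by rewrite ltr_pwDr// le_max lexx orbT.
have ylip s t : s \in `[a, b] -> t \in `[a, b] -> `|y s - y t| <= K * `|s - t|.
  move=> sab tab; apply: (Mlip K _ (s, t)) => //=.
  by rewrite /K (@le_lt_trans _ _ (Num.max M 0))// ?le_max ?lexx// ltrDl.
(* Clamping to [[a, b]] extends [y] to the whole line, as [nonexpansive_density] requires. *)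
pose c (t : R) := Num.min b (Num.max a t).
have cab t : c t \in `[a, b].
  by rewrite in_itv/= /c le_min ge_min lexx/= (ltW ab)/= le_max lexx.
have cE t : t \in `[a, b] -> c t = t.
  by rewrite in_itv/= => /andP[at_ tb]; rewrite /c max_r// min_r.
have c1 s t : s <= t -> 0 <= c t - c s <= t - s.
  rewrite /c => st; case: (leP a s) => as_; case: (leP a t) => at_;
    rewrite ?(min_r (ltW ab)); case: (leP b s) => bs; case: (leP b t) => bt;
    lra.
pose g t := (y (c t) / K + c t) / 2.
have g1 s t : s <= t -> 0 <= g t - g s <= t - s.
  move=> st; have /andP[c0 c2] := c1 _ _ st.
  have : `|(y (c t) - y (c s)) / K| <= c t - c s.
    rewrite normrM normfV (gtr0_norm K0) ler_pdivrMr// mulrC.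
    by rewrite -[in leRHS](ger0_norm c0); exact: ylip.
  rewrite mulrBl ler_norml /g; lra.
have [w wint wE] := nonexpansive_density (ltW ab) g1.
have cint r t : mu.-integrable `[a, t] (EFin \o cst r).
  exact: (@bounded_segment_integrable _ _ `|r|).
(* On [[a, b]] one has [y t = K * (2 * g t - t)], and [w] is the density of [g]. *)
exists (fun t => 2 * K * w t - K); split.
  have KwI : mu.-integrable `[a, b] (fun t => (2 * K)%:E * (w t)%:E)%E.
    exact: integrableZl.
  by apply: eq_integrable (integrableB _ KwI (cint K b)).
move=> t tab; have /andP[at_ tb] : a <= t <= b by move: tab; rewrite in_itv.
have KwI : mu.-integrable `[a, t] (fun t => (2 * K)%:E * (w t)%:E)%E.
  apply: integrableZl => //.
  by apply: integrableS wint => //; apply: subset_itvl; rewrite bnd_simp.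
have wint' : mu.-integrable `[a, t] (EFin \o w).
  by apply: integrableS wint => //; apply: subset_itvl; rewrite bnd_simp.
rewrite (@RintegralB _ _ _ mu _ (fun t => 2 * K * w t) (cst K))//.
rewrite RintegralZl// -wE// Rintegral_cst//= lebesgue_measure_segment//=.
have aab : a \in `[a, b] by rewrite in_itv/= lexx ltW.
rewrite /g !cE//; field; exact: lt0r_neq0.
Qed.

End lipschitz_density.

(** * Integration against a measure with a density *)

(** Integrability of [m] makes [nu] finite. Its Radon-Nikodym derivative, for which the formula is
    known, has the same integral as [m] over every measurable set, hence equals [m] almost
    everywhere. *)
Lemma ge0_integral_density d (T : measurableType d) (R : realType)
    (nu : {measure set T -> \bar R})
    (mu : {sigma_finite_measure set T -> \bar R}) (m : T -> R) (g : T -> \bar R) :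
  mu.-integrable setT (EFin \o m) -> (forall t, 0 <= m t) ->
  (forall A, measurable A -> nu A = \int[mu]_(t in A) (m t)%:E)%E ->
  measurable_fun setT g -> (forall t, 0 <= g t)%E ->
  (\int[nu]_t g t = \int[mu]_t (g t * (m t)%:E))%E.
Proof.
move=> mint m0 nuE mg g0.
have mm : measurable_fun setT (EFin \o m) := measurable_int _ mint.
have nuT : (nu setT < +oo)%E.
  by rewrite nuE//; apply: integrable_lty.
pose nu' : {finite_measure set T -> \bar R} := mfrestr measurableT nuT.
have nu'E : nu = nu' :> (set T -> \bar R).
  by apply/funext => A; rewrite /nu' /= /mfrestr /mrestr setIT.
have numu : nu' `<< mu.
  apply/null_content_dominatesP => A mA A0; rewrite -nu'E nuE//.
  by apply: null_set_integral => //; exact: measurable_funTS.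
rewrite nu'E -(Radon_Nikodym_SigmaFinite.change_of_variables numu)//.
set r := Radon_Nikodym_SigmaFinite.f _ _.
have rint : mu.-integrable setT r := Radon_Nikodym_SigmaFinite.f_integrable numu.
apply: ge0_ae_eq_integral => //.
- by apply: emeasurable_funM => //; exact: measurable_int rint.
- exact: emeasurable_funM.
- by move=> t _; rewrite mule_ge0//; exact: Radon_Nikodym_SigmaFinite.f_ge0.
- by move=> t _; rewrite mule_ge0// lee_fin.
have : ae_eq mu setT r (EFin \o m).
  apply: integral_ae_eq => // E _ mE.
  by rewrite -(Radon_Nikodym_SigmaFinite.f_integral numu)// -nu'E nuE.
by apply: filterS => t /= h /h ->.
Qed.

(** The restricted measure has the indicator of [D] as density. *)
Lemma ge0_integral_mrestr d (T : measurableType d) (R : realType)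
    (mu : {sigma_finite_measure set T -> \bar R}) (D : set T)
    (mD : measurable D) (g : T -> \bar R) :
  (mu D < +oo)%E -> measurable_fun setT g -> (forall t, 0 <= g t)%E ->
  (\int[mrestr mu mD]_t g t = \int[mu]_(t in D) g t)%E.
Proof.
move=> Dfin mg g0.
rewrite (@ge0_integral_density _ _ _ (mrestr mu mD) mu (\1_D))//.
- rewrite [RHS]integral_mkcond; apply: eq_integral => t _.
  by rewrite patchE indicE; case: (t \in D); rewrite ?mule1 ?mule0.
- apply/integrableP; split; first exact/measurable_EFinP.
  under eq_integral do rewrite /= ger0_norm//.
  by rewrite integral_indic// setIT.
- by move=> A mA; rewrite integral_indic// setIC.
Qed.

(* The canonical measure structure on [pushforward m f] depends on a proof that
   f is measurable, which type inference cannot supply. *)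
Lemma pushforward_measure_ex d1 d2 (T1 : measurableType d1)
    (T2 : measurableType d2) (R : realType) (m : {measure set T1 -> \bar R})
    (f : T1 -> T2) : measurable_fun setT f ->
  exists nu : {measure set T2 -> \bar R},
    nu = pushforward m f :> (set T2 -> \bar R).
Proof.
by move=> mf; unshelve eexists (pushforward m f : {measure set T2 -> \bar R}).
Qed.

(** * The time change with prescribed speed *)

Section time_change.
Context {R : realType} (a b e : R) (m : R -> R).
Notation mu := (@lebesgue_measure R).
Hypotheses (ab : a < b) (e0 : 0 < e).
Hypothesis mint : mu.-integrable `[a, b] (EFin \o m).
Hypothesis me : forall t, t \in `[a, b] -> e <= m t.
Hypothesis mab : \int[mu]_(t in `[a, b]) m t = b - a.

Let psi t := a + \int[mu]_(s in `[a, t]) m s.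

Let psiB s t : a <= s -> s <= t -> t <= b ->
  psi t - psi s = \int[mu]_(x in `]s, t]) m x.
Proof.
move=> as_ st tb; rewrite /psi opprD addrACA subrr add0r.
apply: Rintegral_itvB; rewrite ?bnd_simp//.
by apply: integrableS mint => //; apply: subset_itvl; rewrite bnd_simp.
Qed.

(** Integrates the bound [e <= m]; this makes [psi] strictly increasing, hence invertible. *)
Let le_psi s t : a <= s -> s <= t -> t <= b -> e * (t - s) <= psi t - psi s.
Proof.
move=> as_ st tb; rewrite psiB//.
have sub : `]s, t]%classic `<=` `[a, b]%classic.
  by apply: subset_itv; rewrite bnd_simp.
have -> : e * (t - s) = \int[mu]_(x in `]s, t]) cst e x.
  rewrite Rintegral_cst//; congr (_ * _).
  by have /(congr1 fine)/= <- := lebesgue_stieltjes_measure_ocitv idfun st.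
apply: le_Rintegral => //.
- apply: (@integrableS _ _ _ mu `[a, b]) => //.
  exact: (@bounded_segment_integrable _ _ _ `|e|).
- exact: integrableS mint.
- by move=> x /sub; exact: me.
Qed.

Let psia : psi a = a.
Proof. by rewrite /psi set_itv1 Rintegral_set1 addr0. Qed.

Let psib : psi b = b.
Proof. by rewrite /psi mab subrKC. Qed.

Let psi_mono : {in `[a, b] &, {mono psi : s t / s <= t}}.
Proof.
apply: le_mono_in => s t; rewrite !in_itv/= => /andP[as_ sb] /andP[at_ tb] st.
rewrite -subr_gt0; apply: lt_le_trans (le_psi as_ (ltW st) tb).
by rewrite mulr_gt0// subr_gt0.
Qed.

Let clamp s := Num.min b (Num.max a s).

Let clamp_itv s : clamp s \in `[a, b].
Proof. by rewrite in_itv/= /clamp le_min ge_min lexx/= (ltW ab)/= le_max lexx. Qed.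

Let clampE s : s \in `[a, b] -> clamp s = s.
Proof. by rewrite in_itv/= /clamp => /andP[as_ sb]; rewrite max_r// min_r. Qed.

Let psi_surj s : exists t, t \in `[a, b] /\ psi t = clamp s.
Proof.
have Ic := parameterized_integral_continuous (ltW ab) mint.
have [|t tab tE] := IVT (v := clamp s - a) (ltW ab) Ic; last first.
  exists t; split=> //; move: tE; rewrite /psi /parameterized_integral => ->.
  by rewrite subrKC.
rewrite /parameterized_integral set_itv1 Rintegral_set1 mab.
rewrite min_l ?max_r ?subr_ge0 ?(ltW ab)// lerD2r.
by have := clamp_itv s; rewrite in_itv.
Qed.

(** The inverse of [psi], made total by clamping its argument: it is then nondecreasing on the whole
    line, hence measurable there. *)
Let phi s := sval (cid (psi_surj s)).

Let phi_itv s : phi s \in `[a, b].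
Proof. by rewrite /phi; case: cid => t []. Qed.

Let phiK s : psi (phi s) = clamp s.
Proof. by rewrite /phi; case: cid => t []. Qed.

Let phi_nd : {homo phi : s t / s <= t}.
Proof.
move=> s t st; rewrite -psi_mono// !phiK /clamp.
by rewrite le_min !ge_min lexx/= ge_max !le_max lexx st !orbT.
Qed.

Let phi_mono : {in `[a, b] &, {mono phi : s t / s <= t}}.
Proof. by move=> s t sab tab; rewrite -[LHS]psi_mono// !phiK !clampE. Qed.

Let aab : a \in `[a, b]. Proof. by rewrite in_itv/= lexx ltW. Qed.
Let bab : b \in `[a, b]. Proof. by rewrite in_itv/= lexx ltW. Qed.

Let phia : phi a = a.
Proof. by apply: (inc_inj_in psi_mono) => //; rewrite phiK psia clampE. Qed.

Let phib : phi b = b.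
Proof. by apply: (inc_inj_in psi_mono) => //; rewrite phiK psib clampE. Qed.

Let mD : measurable (`[a, b]%classic : set (measurableTypeR R)).
Proof. exact: measurable_itv. Qed.

Let phi_meas : measurable_fun setT (phi : measurableTypeR R -> measurableTypeR R).
Proof. exact: (@nondecreasing_measurable R setT phi measurableT phi_nd). Qed.

Let m0 := m \_ `[a, b].

Let m0_ge0 t : 0 <= m0 t.
Proof.
rewrite /m0 patchE; case: ifPn => // /set_mem tab.
by apply: le_trans (me tab); exact: ltW.
Qed.

Let m0_int : mu.-integrable setT (EFin \o m0).
Proof. by rewrite -restrict_EFin; apply/(integrable_mkcond _ mD). Qed.

Let integral_m0 (A : set R) :
  (\int[mu]_(t in A) (m0 t)%:E = \int[mu]_(t in A `&` `[a, b]) (m t)%:E)%E.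
Proof.
by rewrite integral_mkcondr; apply: eq_integral => t _; rewrite /m0 !patchE;
  case: ifP.
Qed.

Let integral_m t : t \in `[a, b] ->
  (\int[mu]_(s in `[a, t]) (m s)%:E = (psi t - a)%:E)%E.
Proof.
rewrite in_itv/= => /andP[at_ tb].
rewrite /psi addrAC subrr add0r /Rintegral fineK//.
apply: integrable_fin_num => //; apply: integrableS mint => //.
by apply: subset_itvl; rewrite bnd_simp.
Qed.

(** As [psi] is strictly increasing, [phi s < t] amounts to [s = psi (phi s) < psi t] for [s] in
    [[a, b]]. *)
Let preimage_phi_ray t : t \in `[a, b] ->
  phi @^-1` `]-oo, t[%classic `&` `[a, b]%classic = `[a, psi t[%classic.
Proof.
move=> tab; apply/seteqP; split => s /=.
  rewrite in_itv/= => -[st sab]; rewrite in_itv/=.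
  move: (sab); rewrite in_itv/= => /andP[-> _] /=.
  by rewrite -[s]clampE// -phiK ltNge psi_mono// -ltNge.
rewrite !in_itv/= => /andP[as_ st].
have sab : s \in `[a, b].
  rewrite in_itv/= as_/= -psib; apply: le_trans (ltW st) _.
  by rewrite psi_mono//; move: tab; rewrite in_itv => /andP[].
split; last by move: sab; rewrite in_itv.
by rewrite ltNge -psi_mono// -ltNge phiK clampE.
Qed.

(** The push-forward under [phi] of Lebesgue measure on [[a, b]] and the measure of density [m0]
    agree on open left rays. These are stable under intersection and generate the Borel sets, so the
    two measures coincide. *)
Let measure_preimage_phi (A : set (measurableTypeR R)) : measurable A ->
  mrestr mu mD (phi @^-1` A) = (\int[mu]_(t in A) (m0 t)%:E)%E.
Proof.
have [nu nuE] := pushforward_measure_ex (mrestr mu mD) phi_meas.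
have dens_ge0 B : (0 <= induced_charge m0_int B)%E.
  by apply: integral_ge0 => t _; rewrite lee_fin.
pose dens : {measure set (measurableTypeR R) -> \bar R} :=
  measure_of_charge (induced_charge m0_int) dens_ge0.
move=> mA; suff : nu A = dens A by rewrite nuE.
apply: (@measure_unique _ R (measurableTypeR R) (@RGenInftyO.G R)
  (fun n => `]-oo, n%:R[%classic) _ _ _ _ nu dens) => //.
- exact: RGenInftyO.measurableE.
- move=> _ _ [s ->] [t ->]; exists (Num.min s t).
  by apply/seteqP; split => x /=; rewrite !in_itv/= lt_min => /andP.
- by move=> n; exists n%:R.
- apply/seteqP; split => // x _; exists (Num.bound `|x|) => //=.
  by rewrite in_itv/=; exact: le_lt_trans (ler_norm x) (archi_boundP (normr_ge0 x)).
- move=> _ [t ->]; rewrite nuE -[RHS]/(\int[mu]_(t in _) (m0 t)%:E)%E.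
  rewrite integral_m0.
  rewrite -[LHS]/(mu (phi @^-1` `]-oo, t[%classic `&` `[a, b]%classic)).
  (* The ray misses [[a, b]], ends inside it, or contains it; both masses are 0, [psi t - a] and
     [b - a] respectively. *)
  have [ta|at_] := leP t a.
    rewrite (_ : _ `&` _ = set0) ?measure0.
      rewrite (_ : _ `&` _ = set0) ?integral_set0//.
      rewrite -subset0 => s /= []; rewrite !in_itv/= => st /andP[as_ _].
      by move: st; rewrite ltNge (le_trans ta).
    rewrite -subset0 => s /= [] + _; have := phi_itv s.
    rewrite !in_itv/= => /andP[as_ _] st.
    by move: st; rewrite ltNge (le_trans ta).
  have [tb|bt] := leP t b.
    have tab : t \in `[a, b] by rewrite in_itv/= tb ltW.
    rewrite preimage_phi_ray//.
    have -> : (`]-oo, t[ `&` `[a, b] = `[a, t[)%classic.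
      apply/seteqP; split => s /=; rewrite !in_itv/=.
        by move=> [-> /andP[-> _]].
      by move=> /andP[as_ st]; rewrite as_ st/= (le_trans (ltW st)).
    rewrite integral_itv_bndo_bndc; last first.
      apply: measurable_funS (measurable_int _ mint) => //.
      by apply: subset_itvl; rewrite bnd_simp.
    rewrite integral_m// [mu _]lebesgue_measure_itv/= lte_fin.
    by rewrite -{1}psia ltNge psi_mono// -ltNge at_.
  rewrite (_ : _ `&` _ = `[a, b]%classic); last first.
    apply/setIidPr => s /= _; rewrite in_itv/=; apply: le_lt_trans bt.
    by have := phi_itv s; rewrite in_itv => /andP[].
  rewrite (_ : _ `&` _ = `[a, b]%classic); last first.
    by apply/setIidPr => s /=; rewrite !in_itv/= => /andP[_ /le_lt_trans]; apply.
  by rewrite integral_m// psib; apply: lebesgue_measure_segment; exact: ltW.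
- move=> k; rewrite nuE; apply: le_lt_trans (lebesgue_measure_segment_ltey a b).
  apply: le_measure; rewrite ?inE//.
  apply: measurableI => //; rewrite -[X in measurable X]setTI; exact: phi_meas.
Qed.

(** The integral formula is the substitution [s = psi t]: integrate [g] against the push-forward
    under [phi], then against its density [m0]. *)
Lemma time_change : exists phi : R -> R,
  [/\ measurable_fun setT phi, phi a = a /\ phi b = b,
      forall s, phi s \in `[a, b],
      {in `[a, b] &, {mono phi : s t / s <= t}} &
      forall g : R -> \bar R, measurable_fun setT g -> (forall t, 0 <= g t)%E ->
        (\int[mu]_(s in `[a, b]) g (phi s) =
         \int[mu]_(t in `[a, b]) (g t * (m t)%:E))%E ].
Proof.
exists phi; split => // g mg g0.
have mgphi : measurable_fun setT (g \o phi) by exact: measurableT_comp.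
transitivity (\int[mrestr mu mD]_s (g \o phi) s)%E.
  apply/esym/ge0_integral_mrestr => //; last by move=> s; exact: g0.
  exact: lebesgue_measure_segment_ltey.
have [nu nuE] := pushforward_measure_ex (mrestr mu mD) phi_meas.
transitivity (\int[nu]_t g t)%E.
  by rewrite nuE (ge0_integral_pushforward phi_meas (mrestr mu mD) (D := setT)).
rewrite (ge0_integral_density m0_int)//.
  rewrite [RHS]integral_mkcond; apply: eq_integral => t _.
  by rewrite /m0 !patchE; case: ifP; rewrite ?mule0.
by move=> A mA; rewrite nuE; exact: measure_preimage_phi.
Qed.

End time_change.

(** * Measurability of the integrands *)

(** The open set where [L] exceeds [r] is the countable union of the rational boxes it contains, and
    the preimage of a box under [(u, v)] is the intersection of a preimage under [u] and one under
    [v]. Boxes that are not contained contribute the empty set. *)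
Lemma measurable_fun_continuous2 d (T : measurableType d) (R : realType)
    (L : R * R -> R) (u v : T -> R) :
  continuous L -> measurable_fun setT u -> measurable_fun setT v ->
  measurable_fun setT (fun t => L (u t, v t)).
Proof.
move=> Lc mu mv; apply: (measurability _ (RGenOInfty.measurableE R)).
move=> _ [_ [r ->] <-]; rewrite setTI.
pose O := L @^-1` `]r, +oo[%classic.
have Oopen : open O by apply: open_comp => [p _|]; [exact: Lc|exact: interval_open].
pose box (i : (rat * rat) * (rat * rat)) : set (R * R) :=
  `]ratr i.1.1, ratr i.1.2[%classic `*` `]ratr i.2.1, ratr i.2.2[%classic.
rewrite [X in measurable X](_ : _ = \bigcup_i
  (if pselect (box i `<=` O) then
    u @^-1` `]ratr i.1.1, ratr i.1.2[%classic `&`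
    v @^-1` `]ratr i.2.1, ratr i.2.2[%classic else set0)); last first.
  apply/seteqP; split => [t Ot|t [i _]].
    have /nbhs_ballP[e /= e0 eO] : nbhs (u t, v t) O by exact: open_nbhs_nbhs.
    have lt1 (z : R) : z - e < z by rewrite gtrBl.
    have lt2 (z : R) : z < z + e by rewrite ltrDl.
    have [p1 +] := rat_in_itvoo (lt1 (u t)); rewrite in_itv/= => /andP[p1l p1r].
    have [p2 +] := rat_in_itvoo (lt2 (u t)); rewrite in_itv/= => /andP[p2l p2r].
    have [q1 +] := rat_in_itvoo (lt1 (v t)); rewrite in_itv/= => /andP[q1l q1r].
    have [q2 +] := rat_in_itvoo (lt2 (v t)); rewrite in_itv/= => /andP[q2l q2r].
    exists ((p1, p2), (q1, q2)) => //; case: pselect => [iO|niO] /=.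
      by split; rewrite /= in_itv/=; apply/andP; split.
    case: niO => -[x y] /=; rewrite /box/= !in_itv/= => -[/andP[x1 x2] /andP[y1 y2]].
    apply: eO; split; rewrite /ball/= ltr_distl; apply/andP; split; lra.
  by case: pselect => //= iO [ui vi]; apply: (iO (u t, v t)).
apply: countable_bigcupT_measurable => // i.
case: pselect => iO /=; last exact: measurable0.
apply: measurableI; rewrite -[X in measurable X]setTI.
  exact: mu.
exact: mv.
Qed.

Lemma primitive_measurable (R : realType) (a b : R) (f y : R -> R) : a <= b ->
  (@lebesgue_measure R).-integrable `[a, b] (EFin \o f) ->
  (forall t, t \in `[a, b] ->
    y t = y a + \int[@lebesgue_measure R]_(s in `[a, t]) f s) ->
  measurable_fun `[a, b] y.
Proof.
move=> ab fint yE.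
have Ic := parameterized_integral_continuous ab fint.
have mI := subspace_continuous_measurable_fun (measurable_itv `[a, b]) Ic.
apply: (eq_measurable_fun
  (fun t => y a + \int[@lebesgue_measure R]_(s in `[a, t]) f s)).
  by move=> t /set_mem tab; rewrite [RHS]yE.
by apply: measurable_funD => //; exact: mI.
Qed.

(** * The reparametrized curve and its action *)

Section reparametrization.
Context {R : realType} (a b e k : R) (f m y : R -> R).
Notation mu := (@lebesgue_measure R).
Hypotheses (ab : a < b) (e0 : 0 < e).
Hypothesis fint : mu.-integrable `[a, b] (EFin \o f).
Hypothesis yE : forall t, t \in `[a, b] ->
  y t = y a + \int[mu]_(s in `[a, t]) f s.
Hypothesis mint : mu.-integrable `[a, b] (EFin \o m).
Hypothesis me : forall t, t \in `[a, b] -> e <= m t.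
Hypothesis mab : \int[mu]_(t in `[a, b]) m t = b - a.
Hypothesis fm : forall t, t \in `[a, b] -> `|f t| <= k * m t.

Let m_gt0 t : t \in `[a, b] -> 0 < m t.
Proof. by move/me; exact: lt_le_trans. Qed.

(** The velocity of the new curve, as a function of the old time. Extension by zero makes it
    measurable and bounded on the whole line. *)
Let h0 := (fun t => f t / m t) \_ `[a, b].

Let mh0 : measurable_fun setT h0.
Proof.
apply/(measurable_restrictT _ _).1 => //.
have mf : measurable_fun `[a, b] f by apply/measurable_EFinP; exact: measurable_int fint.
have mm : measurable_fun `[a, b] m by apply/measurable_EFinP; exact: measurable_int mint.
apply: measurable_funM => //.
(* On [a, b], [m] takes values where the inverse is monotone. *)
pose ninv x := - (Num.max e x)^-1.
have mninv : measurable_fun setT ninv.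
  apply: nondecreasing_measurable => // s t st; rewrite /ninv lerN2 lef_pV2.
  - by rewrite ge_max !le_max lexx st orbT.
  - by rewrite posrE lt_max e0.
  - by rewrite posrE lt_max e0.
apply: (eq_measurable_fun (fun t => - ninv (m t))).
  by move=> t /set_mem tab; rewrite /ninv opprK max_r//; exact: me.
by apply: measurableT_comp => //; exact: measurableT_comp.
Qed.

Let h0E t : t \in `[a, b] -> h0 t = f t / m t.
Proof. by move=> tab; rewrite /h0 patchE ifT// inE. Qed.

Let k_ge0 : 0 <= k.
Proof.
have aab : a \in `[a, b] by rewrite in_itv/= lexx ltW.
by rewrite -(pmulr_lge0 _ (m_gt0 aab)); exact: le_trans (fm aab).
Qed.

Let h0_le t : `|h0 t| <= k.
Proof.
rewrite /h0 patchE; case: ifPn => [/set_mem tab|_]; last by rewrite normr0.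
rewrite normrM normfV (gtr0_norm (m_gt0 tab)) ler_pdivrMr ?m_gt0//.
exact: fm.
Qed.

(** The curve is [z = y \o phi], with density [h0 \o phi] bounded by [k]. Measurability of the new
    integrand is recorded for the later comparison of integrals. *)
Lemma reparametrization : exists z : R -> R,
  [/\ lipschitz_fun a b z, z a = y a, z b = y b &
    forall L : R * R -> R, continuous L -> (forall p, 0 <= L p) ->
      measurable_fun `[a, b] (fun t => L (y t, f t / m t) * m t) /\
      action L a b z =
      (\int[mu]_(t in `[a, b]) (L (y t, f t / m t) * m t)%:E)%E].
Proof.
have [phi [mphi [phia phib] phi_itv phi_mono chg0]] := time_change ab e0 mint me mab.
have mkcond D (g : R -> \bar R) :
    (\int[mu]_(x in D) g x = \int[mu]_x (g \_ D) x)%E by exact: integral_mkcond.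
(* The change of variables for signed [g]: the positive factor [m t] passes through positive and
   negative parts. *)
have chg (g : R -> \bar R) : measurable_fun setT g ->
    (\int[mu]_(s in `[a, b]) g (phi s) =
     \int[mu]_(t in `[a, b]) (g t * (m t)%:E))%E.
  move=> mg; rewrite [LHS]integralE [RHS]integralE; congr (_ - _)%E.
    transitivity (\int[mu]_(t in `[a, b]) (g^\+ t * (m t)%:E))%E.
      rewrite -(chg0 (g^\+)%E)//; last exact: measurable_funepos.
      by apply: eq_integral => s _; rewrite !funeposE.
    apply: eq_integral => t; rewrite inE => tab; rewrite !funeposE muleC.
    by rewrite maxe_pMr ?mule0 1?muleC// lee_fin ltW// m_gt0.
  transitivity (\int[mu]_(t in `[a, b]) (g^\- t * (m t)%:E))%E.
    rewrite -(chg0 (g^\-)%E)//; last exact: measurable_funeneg.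
      by apply: eq_integral => s _; rewrite !funenegE.
  apply: eq_integral => t; rewrite inE => tab; rewrite !funenegE muleC.
  by rewrite maxe_pMr ?mule0 ?muleN 1?(muleC (m t)%:E)// lee_fin ltW// m_gt0.
pose h s := h0 (phi s).
have mh : measurable_fun setT h by exact: measurableT_comp.
have hint s t : mu.-integrable `[s, t] (EFin \o h).
  apply: (bounded_segment_integrable (M := k)); first exact: measurable_funTS.
  by move=> x _; exact: h0_le.
pose z s := y (phi s).
have za : z a = y a by rewrite /z phia.
have zE s : s \in `[a, b] -> z s = z a + \int[mu]_(x in `[a, s]) h x.
  move=> sab; rewrite za /z yE//; congr (_ + _); rewrite /Rintegral; congr fine.
  (* Since [phi x <= phi s] means [x <= s], composing [G] with [phi] cuts [h] off at [s], while [G]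
     times [m] is [f] on [[a, phi s]]. *)
  pose G := (EFin \o h0) \_ `[a, phi s].
  have mG : measurable_fun setT G.
    by apply/(measurable_restrictT _ _).1 => //; apply/measurable_EFinP;
      exact: measurable_funTS.
  have [as_ sb] : a <= s /\ s <= b by move: sab; rewrite in_itv => /andP[].
  transitivity (\int[mu]_(x in `[a, b]) G (phi x))%E; last first.
    rewrite [LHS]mkcond [RHS]mkcond; apply: eq_integral => x _.
    rewrite !patchE /G patchE; case: ifPn => [/set_mem xab|xab].
      have xsE : (phi x \in `[a, phi s]%classic) = (x \in `[a, s]%classic).
        rewrite !(mem_setE, in_itv)/= phi_mono//.
        have := xab; have := phi_itv x; rewrite /= !in_itv/=.
        by move=> /andP[-> _] /andP[-> _].
      by rewrite xsE.
    case: ifPn => // /set_mem xas; move/negP: xab; case.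
    rewrite inE/= in_itv/=; move: xas; rewrite /= in_itv/= => /andP[-> xs] /=.
    exact: le_trans xs sb.
  rewrite chg// [LHS]mkcond [RHS]mkcond.
  apply: eq_integral => t _; rewrite !patchE /G patchE.
  have phisb : phi s <= b by have := phi_itv s; rewrite in_itv => /andP[].
  case: ifPn => [/set_mem tas|tas].
    have tab : t \in `[a, b].
      move: tas; rewrite /= !in_itv/= => /andP[-> ts]; exact: le_trans ts phisb.
    by rewrite mem_setE tab/= h0E// -EFinM divfK// gt_eqF// m_gt0.
  by case: ifPn => // _; rewrite mul0e.
have zlip : lipschitz_fun a b z.
  have zlip s t : s \in `[a, b] -> t \in `[a, b] -> s <= t ->
      `|z t - z s| <= k * (t - s).
    move=> sab tab st; rewrite (zE s)// (zE t)// opprD addrACA subrr add0r.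
    have [as_ tb] : a <= s /\ t <= b.
      by move: sab tab; rewrite !in_itv/= => /andP[-> _] /andP[_ ->].
    rewrite Rintegral_itvB ?bnd_simp//.
    have hst : mu.-integrable `]s, t] (EFin \o h).
      apply: (@integrableS _ _ _ mu `[s, t]) => //.
      by apply: subset_itvr; rewrite bnd_simp.
    apply: (le_trans (le_normr_Rintegral _ _)) => //.
    have -> : k * (t - s) = \int[mu]_(x in `]s, t]) cst k x.
      rewrite Rintegral_cst//; congr (_ * _).
      by have /(congr1 fine)/= <- := lebesgue_stieltjes_measure_ocitv idfun st.
    apply: le_Rintegral => //.
    - exact: (integrable_norm hst).
    - apply: (@integrableS _ _ _ mu `[s, t]) => //.
        by apply: subset_itvr; rewrite bnd_simp.
      exact: (@bounded_segment_integrable _ _ _ `|k|).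
    - by move=> x _; exact: h0_le.
  exists k; split; first exact: num_real.
  move=> K kK [s t] [/= sab tab].
  wlog st : s t sab tab / s <= t.
    move=> hw; have [/hw|/ltW/hw] := leP s t; first exact.
    by rewrite distrC (distrC t); exact.
  rewrite distrC (distrC s) (@ger0_norm _ (t - s)) ?subr_ge0//.
  apply: le_trans (zlip _ _ sab tab st) _.
  by rewrite ler_wpM2r ?subr_ge0// ltW.
exists z; split=> //; first by rewrite /z phib.
move=> L Lc L0; rewrite (action_density ab L0 (hint a b) zE).
have my : measurable_fun setT (y \_ `[a, b]).
  apply/(measurable_restrictT _ _).1 => //.
  exact: primitive_measurable (ltW ab) fint yE.
have mL : measurable_fun setT (fun t => L ((y \_ `[a, b]) t, h0 t)).
  exact: measurable_fun_continuous2.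
split.
  apply: (eq_measurable_fun (fun t => L ((y \_ `[a, b]) t, h0 t) * m t)).
    by move=> t tab; rewrite patchE tab h0E//; exact: set_mem.
  apply: measurable_funM; first exact: measurable_funTS.
  by apply/measurable_EFinP; exact: measurable_int mint.
pose g t := (L ((y \_ `[a, b]) t, h0 t))%:E.
transitivity (\int[mu]_(s in `[a, b]) g (phi s))%E.
  apply: eq_integral => s _; rewrite /g patchE ifT//.
  by rewrite inE/=; exact: phi_itv.
rewrite chg.
  apply: eq_integral => t; rewrite inE => tab.
  by rewrite /g patchE ifT ?inE// h0E// EFinM.
by apply/measurable_EFinP.
Qed.

End reparametrization.

(** * Construction of the speed *)

(** The order of quantifiers matters: [c] is fixed before [e], so that [e] may later be chosen from
    a bound on [L] that depends on [c]. *)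
Lemma time_density (R : realType) (a b : R) (f : R -> R) : a < b ->
  (@lebesgue_measure R).-integrable `[a, b] (EFin \o f) ->
  exists2 c : R, 0 <= c & forall e : R, 0 < e -> exists (k : R) (m : R -> R),
    [/\ (@lebesgue_measure R).-integrable `[a, b] (EFin \o m),
        \int[@lebesgue_measure R]_(t in `[a, b]) m t = b - a,
        \int[@lebesgue_measure R]_(t in `[a, b]) `|m t - 1| <= e &
        forall t, [/\ 2^-1 <= m t, `|f t| <= k * m t & m t < 1 -> `|f t| <= c]].
Proof.
set mu := @lebesgue_measure R; move=> ab fint.
have ba0 : 0 < b - a by rewrite subr_gt0.
pose C := \int[mu]_(t in `[a, b]) `|f t|.
have C0 : 0 <= C by apply: Rintegral_ge0 => t _.
(* Since [chi >= 1 - |f| / c], this choice gives [chi] an integral of at least half of [b - a]; the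
   added 1 keeps [c] positive when [C = 0]. *)
pose c := 2 * C / (b - a) + 1.
have Cba0 : 0 <= C / (b - a) by rewrite divr_ge0// ltW.
have c0 : 0 < c by rewrite /c -mulrA ltr_wpDl// mulr_ge0.
exists c => [|e e0]; first exact: ltW.
(* The summands serve, in order, [c <= k], [d <= 1/2] and [2 * eta <= e]; the last two use
   [eta <= C / k]. *)
pose k := c + 4 * (C / (b - a)) + 2 * (C / e).
have Ce0 : 0 <= C / e by rewrite divr_ge0// ltW.
have ck : c <= k by rewrite /k; lra.
have k0 : 0 < k by exact: lt_le_trans ck.
pose chi t := Num.max 0 (1 - `|f t| / c).
pose q t := Num.max 0 (`|f t| / k - 1).
have mf : measurable_fun `[a, b] f by apply/measurable_EFinP; exact: measurable_int fint.
have mnf : measurable_fun `[a, b] (fun t => `|f t|) by exact: measurableT_comp.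
have nfint : mu.-integrable `[a, b] (EFin \o (fun t => `|f t|)).
  exact: (integrable_norm fint).
have nfint' r : mu.-integrable `[a, b] (EFin \o (fun t => `|f t| / r)).
  have h : mu.-integrable `[a, b] (fun t => (r^-1)%:E * (`|f t|)%:E)%E.
    exact: integrableZl.
  by apply: eq_integrable h => // t _; rewrite /= -EFinM mulrC.
have cint r : mu.-integrable `[a, b] (EFin \o cst r).
  exact: (@bounded_segment_integrable _ _ _ `|r|).
have mchi : measurable_fun `[a, b] chi.
  apply: measurable_maxr => //; apply: measurable_funB => //.
  exact: measurable_funM.
have mq : measurable_fun `[a, b] q.
  apply: measurable_maxr => //; apply: measurable_funB => //.
  exact: measurable_funM.
have chi0 t : 0 <= chi t by rewrite le_max lexx.
have q0 t : 0 <= q t by rewrite le_max lexx.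
have chi1 t : chi t <= 1.
  by rewrite ge_max ler01/= gerBl divr_ge0// ltW.
have chiint : mu.-integrable `[a, b] (EFin \o chi).
  by apply: (bounded_segment_integrable (M := 1)) => // t _; rewrite ger0_norm.
have q_le t : q t <= `|f t| / k.
  by rewrite ge_max divr_ge0 ?(ltW k0)//= gerBl.
have qint : mu.-integrable `[a, b] (EFin \o q).
  apply: le_integrable (nfint' k) => //; first exact/measurable_EFinP.
  move=> t _ /=; rewrite lee_fin (ger0_norm (q0 t)); apply: le_trans (q_le t) _.
  exact: ler_norm.
pose eta := \int[mu]_(t in `[a, b]) q t.
pose ep := \int[mu]_(t in `[a, b]) chi t.
have intn r : \int[mu]_(t in `[a, b]) (`|f t| / r) = C / r by rewrite RintegralZr.
have cst1 : \int[mu]_(t in `[a, b]) cst 1 t = b - a.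
  by rewrite Rintegral_cst// [X in fine X]lebesgue_measure_segment ?ltW//= mul1r.
have eta_le : eta <= C / k by rewrite -intn; exact: le_Rintegral.
have eta0 : 0 <= eta by exact: Rintegral_ge0.
have ep_ge : (b - a) / 2 <= ep.
  apply: (@le_trans _ _ (\int[mu]_(t in `[a, b]) (cst 1 t - `|f t| / c))).
    rewrite RintegralB// cst1 intn lerBrDr -lerBrDl ler_pdivrMr//.
    have : c * (b - a) = 2 * C + (b - a) by rewrite /c; field; exact: lt0r_neq0.
    by move: c0; nra.
  apply: le_Rintegral => //.
    exact: (integrableB _ (cint 1) (nfint' c)).
  by move=> t _; rewrite le_max lexx orbT.
have ep0 : 0 < ep by apply: lt_le_trans ep_ge; rewrite divr_gt0.
(* With this [d], the integral of [d * chi] cancels that of [q], and that of [|m - 1|] is at most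
   [2 * eta]. *)
pose d := eta / ep.
have d0 : 0 <= d by rewrite divr_ge0// ltW.
have d_le : d <= 2^-1.
  rewrite ler_pdivrMr//; apply: (le_trans eta_le).
  apply: (@le_trans _ _ (2^-1 * ((b - a) / 2))); last by rewrite ler_wpM2l.
  rewrite ler_pdivrMr//.
  have : k >= 4 * (C / (b - a)) by rewrite /k; lra.
  rewrite -(ler_pM2r ba0) -mulrA divfK ?gt_eqF//; lra.
have eta_e : 2 * eta <= e.
  apply: (@le_trans _ _ (2 * (C / k))); first by rewrite ler_wpM2l.
  rewrite mulrA ler_pdivrMr//.
  have : k >= 2 * (C / e) by rewrite /k; lra.
  rewrite -(ler_pM2r e0) -mulrA divfK ?gt_eqF//; lra.
have dchiint : mu.-integrable `[a, b] (EFin \o (fun t => d * chi t)).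
  have h : mu.-integrable `[a, b] (fun t => d%:E * (chi t)%:E)%E.
    exact: integrableZl.
  by apply: eq_integrable h.
have int_dchi : \int[mu]_(t in `[a, b]) (d * chi t) = eta.
  by rewrite RintegralZl// /d divfK// gt_eqF.
have q1int : mu.-integrable `[a, b] (EFin \o (fun t => 1 + q t)).
  exact: (integrableD _ (cint 1) qint).
pose m t := 1 + q t - d * chi t.
have mint : mu.-integrable `[a, b] (EFin \o m).
  exact: (integrableB _ q1int dchiint).
have qdint : mu.-integrable `[a, b] (EFin \o (fun t => q t + d * chi t)).
  exact: (integrableD _ qint dchiint).
have m1int : mu.-integrable `[a, b] (EFin \o (fun t => `|m t - 1|)).
  exact: (integrable_norm (integrableB _ mint (cint 1))).
have chi_gt0 t : 0 < chi t -> `|f t| <= c.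
  by rewrite lt_max ltxx/= subr_gt0 ltr_pdivrMr// mul1r => /ltW.
exists (2 * k), m; split => //.
- have -> : \int[mu]_(t in `[a, b]) m t =
      \int[mu]_(t in `[a, b]) (1 + q t) - \int[mu]_(t in `[a, b]) (d * chi t).
    exact: (RintegralB _ q1int dchiint).
  have -> : \int[mu]_(t in `[a, b]) (1 + q t) =
      \int[mu]_(t in `[a, b]) cst 1 t + \int[mu]_(t in `[a, b]) q t.
    exact: (RintegralD _ (cint 1) qint).
  by rewrite cst1 int_dchi addrK.
- apply: le_trans eta_e.
  apply: (@le_trans _ _ (\int[mu]_(t in `[a, b]) (q t + d * chi t))).
    apply: le_Rintegral => // t _; rewrite /m.
    have := q0 t; have := mulr_ge0 d0 (chi0 t); rewrite ler_norml; lra.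
  have -> : \int[mu]_(t in `[a, b]) (q t + d * chi t) =
      \int[mu]_(t in `[a, b]) q t + \int[mu]_(t in `[a, b]) (d * chi t).
    exact: (RintegralD _ qint dchiint).
  by rewrite int_dchi mulrDl mul1r.
move=> t.
have dchi_ge0 := mulr_ge0 d0 (chi0 t).
have dchi_le : d * chi t <= 2^-1.
  by apply: le_trans d_le; rewrite ler_piMr.
have m_ge : 2^-1 <= m t by rewrite /m; have := q0 t; lra.
split => //; last first.
  move=> m1; apply: chi_gt0; rewrite lt_def chi0 andbT; apply/eqP => chit.
  by move: m1; rewrite /m chit mulr0; have := q0 t; lra.
(* Where [chi] vanishes, [m = 1 + q >= |f| / k]. Elsewhere [|f| <= c <= k], and [m >= 1/2] accounts
   for the factor 2 in [2 * k]. *)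
have [chit|] := eqVneq (chi t) 0.
  have : `|f t| / k <= 1 + q t by rewrite -lerBlDl le_max lexx orbT.
  rewrite ler_pdivrMr// => fk; apply: le_trans fk _.
  rewrite /m chit mulr0 subr0 mulrC -mulrA; have := mulr_ge0 (ltW k0) (q0 t); lra.
rewrite neq_lt ltNge chi0/= => /chi_gt0 fc.
apply: (le_trans (le_trans fc ck)).
move: m_ge k0; clearbody m; nra.
Qed.


(** * Convexity estimates for a rescaled velocity *)

Section convex_scaling.
Context {R : realType} (l : R -> R).
Hypothesis l_convex : convex_function [set: R^o] (l : R^o -> R^o).

Let convexP (t x y : R) : 0 <= t <= 1 ->
  l (t * x + (1 - t) * y) <= t * l x + (1 - t) * l y.
Proof.
move=> /andP[t0 t1].
have := l_convex (Itv01 t0 t1) (in_setT x) (in_setT y).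
by rewrite !convRE.
Qed.

(** Here [v / c] is the convex combination of [v] and 0 with weight [1 / c] on [v]. The error
    involves only [l 0], so large [v] does no harm. *)
Lemma convex_scaling_ge1 (c v : R) : 1 <= c ->
  c * l (v / c) <= l v + (c - 1) * l 0.
Proof.
move=> c1; have c0 : 0 < c by exact: lt_le_trans c1.
have := @convexP c^-1 v 0; rewrite invr_ge0 ltW//= invf_le1// c1 => /(_ isT).
rewrite mulr0 addr0 [_ * v]mulrC -(ler_pM2l c0) => /le_trans; apply.
by rewrite le_eqVlt; apply/orP; left; apply/eqP; field; exact: lt0r_neq0.
Qed.

(** Here [v / c] lies between [v] and [2 * v], with weights [2 - 1 / c] and [1 / c - 1]. After
    multiplication by [c] the weight of [l v] is [2 * c - 1], at most 1. *)
Lemma convex_scaling_le1 (c v : R) : 0 <= l v -> 2^-1 <= c -> c <= 1 ->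
  c * l (v / c) <= l v + (1 - c) * l (2 * v).
Proof.
move=> lv0 c2 c1; have c0 : 0 < c by apply: lt_le_trans c2; rewrite invr_gt0.
have t0 : 0 <= 2 - c^-1.
  by rewrite subr_ge0 -[leRHS]invrK lef_pV2// posrE// invr_gt0.
have t1 : 2 - c^-1 <= 1.
  have : 1 <= c^-1 by rewrite invf_ge1.
  lra.
have := @convexP (2 - c^-1) v (2 * v); rewrite t0 t1 => /(_ isT).
have -> : (2 - c^-1) * v + (1 - (2 - c^-1)) * (2 * v) = v / c by field; exact: lt0r_neq0.
rewrite -(ler_pM2l c0) => /le_trans; apply.
have -> : c * ((2 - c^-1) * l v + (1 - (2 - c^-1)) * l (2 * v)) =
  (2 * c - 1) * l v + (1 - c) * l (2 * v) by field; exact: lt0r_neq0.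
rewrite lerD2r; nra.
Qed.

End convex_scaling.

(** * Lipschitz approximation and equality of the infima *)

Lemma continuous_rectangle_bounded (R : realType) (L : R * R -> R) (Y V : R) :
  continuous L ->
  exists2 M : R, 0 <= M & forall y v, `|y| <= Y -> `|v| <= V -> `|L (y, v)| <= M.
Proof.
move=> Lc.
have Kc : compact (`[- Y, Y]%classic `*` `[- V, V]%classic : set (R * R)).
  by apply: compact_setX; exact: segment_compact.
have := continuous_compact (continuous_subspaceT Lc) Kc.
move=> /compact_bounded[M [_ hM]].
exists (Num.max 0 (M + 1)); first by rewrite le_max lexx.
move=> y v yY vV; rewrite le_max; apply/orP; right.
apply: (hM (M + 1)); first by rewrite ltrDl.
by exists (y, v) => //; split; rewrite /= in_itv/= -ler_norml.
Qed.

Lemma classC1_continuous (R : realType) (L : R * R -> R) :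
  classC1 L -> continuous L.
Proof. by move=> [dL _] p; exact: differentiable_continuous. Qed.

Lemma lipschitz_approximation (R : realType) (a b : R) (L : R * R -> R)
    (y : R -> R) (e : R) : a < b -> continuous L -> (forall p, 0 <= L p) ->
  (forall s, convex_function [set: R^o] (fun v : R^o => L (s, v))) ->
  abs_cont a b y -> 0 < e ->
  exists z : R -> R, [/\ lipschitz_fun a b z, z a = y a, z b = y b &
    (action L a b z <= action L a b y + e%:E)%E].
Proof.
set mu := @lebesgue_measure R.
move=> ab Lc L0 Lconv [f [fint yE]] e0.
have [c c0 hc] := time_density ab fint.
pose C := \int[mu]_(t in `[a, b]) `|f t|.
have yC t : t \in `[a, b] -> `|y t| <= `|y a| + C.
  move=> tab; rewrite yE//; apply: le_trans (ler_normD _ _) _.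
  have sub : `[a, t]%classic `<=` `[a, b]%classic.
    by apply: subset_itvl; move: tab; rewrite in_itv bnd_simp => /andP[].
  have ftint : mu.-integrable `[a, t] (EFin \o f) by exact: integrableS fint.
  rewrite lerD2l; apply: le_trans (le_normr_Rintegral _ ftint) _ => //.
  rewrite /C /Rintegral; apply: fine_le.
  - exact: integrable_fin_num (integrable_norm ftint).
  - exact: integrable_fin_num (integrable_norm fint).
  apply: ge0_subset_integral => //.
  by apply: measurable_int; exact: integrable_norm fint.
(* The rectangle contains [(y t, 0)] for all [t] in [[a, b]], and [(y t, 2 * f t)] whenever
   [m t < 1]: the points where the convexity estimates evaluate [L]. *)
have [M M0 LM] := continuous_rectangle_bounded (`|y a| + C) (2 * c) Lc.
have eM : 0 < e / (M + 1) by rewrite divr_gt0// ltr_wpDl.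
have [k [m [mint mab m1_le hm]]] := hc _ eM.
have half0 : (0 : R) < 2^-1 by [].
have me t : t \in `[a, b] -> 2^-1 <= m t by have [] := hm t.
have fm t : t \in `[a, b] -> `|f t| <= k * m t by have [] := hm t.
have [z [zlip za zb hz]] := reparametrization ab half0 fint yE mint me mab fm.
exists z; split => //.
have [mLm ->] := hz _ Lc L0.
rewrite (action_density ab L0 fint yE).
have cint r : mu.-integrable `[a, b] (EFin \o cst r).
  exact: (@bounded_segment_integrable _ _ _ `|r|).
have m1int : mu.-integrable `[a, b] (EFin \o (fun t => `|m t - 1|)).
  exact: (integrable_norm (integrableB _ mint (cint 1))).
have Mm1int : mu.-integrable `[a, b] (EFin \o (fun t => M * `|m t - 1|)).
  have h : mu.-integrable `[a, b] (fun t => M%:E * (`|m t - 1|)%:E)%E.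
    exact: integrableZl.
  by apply: eq_integrable h.
have mLf : measurable_fun `[a, b] (fun t => L (y t, f t)).
  have my : measurable_fun setT (y \_ `[a, b]).
    apply/(measurable_restrictT _ _).1 => //.
    exact: primitive_measurable (ltW ab) fint yE.
  have mf : measurable_fun setT (f \_ `[a, b]).
    apply/(measurable_restrictT _ _).1 => //.
    by apply/measurable_EFinP; exact: measurable_int fint.
  apply: (eq_measurable_fun (fun t => L ((y \_ `[a, b]) t, (f \_ `[a, b]) t))).
    by move=> t tab; rewrite !patchE tab.
  by apply: measurable_funTS; exact: measurable_fun_continuous2.
(* All terms are nonnegative, so the comparison also covers a curve [y] of infinite action. *)
apply: (@le_trans _ _ (\int[mu]_(t in `[a, b])
    ((L (y t, f t))%:E + (M * `|m t - 1|)%:E))%E).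
  apply: ge0_le_integral => //.
  - move=> t tab; rewrite lee_fin mulr_ge0//.
    by apply: le_trans (me t _) => //; exact: ltW.
  - exact/measurable_EFinP.
  - apply: emeasurable_funD; first exact/measurable_EFinP.
    exact: measurable_int Mm1int.
  move=> t tab; rewrite -EFinD lee_fin mulrC.
  (* Slowing down costs [(m t - 1) * L (y t, 0)], speeding up [(1 - m t) * L (y t, 2 * f t)]; both
     are at most [M * |m t - 1|]. *)
  have [m1|m1] := leP 1 (m t).
    apply: le_trans (convex_scaling_ge1 (Lconv (y t)) (f t) m1) _.
    rewrite lerD2l mulrC ger0_norm ?subr_ge0// ler_wpM2r ?subr_ge0//.
    apply: le_trans (ler_norm _) (LM _ _ (yC _ tab) _).
    by rewrite normr0 mulr_ge0.
  have [m2 _ /(_ m1) fc] := hm t.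
  apply: le_trans (convex_scaling_le1 (Lconv (y t)) (L0 _) m2 (ltW m1)) _.
  have m1' : 0 <= 1 - m t by rewrite subr_ge0 ltW.
  rewrite lerD2l mulrC distrC (ger0_norm m1') ler_wpM2r//.
  apply: le_trans (ler_norm _) (LM _ _ (yC _ tab) _).
  by rewrite normrM ger0_norm// ler_wpM2l.
rewrite ge0_integralD//; first last.
- exact: measurable_int Mm1int.
- by move=> t _; rewrite lee_fin mulr_ge0.
- exact/measurable_EFinP.
- by move=> t _; rewrite lee_fin.
rewrite leeD2l//.
have <- : (\int[mu]_(t in `[a, b]) (M * `|m t - 1|))%:E =
    (\int[mu]_(t in `[a, b]) (M * `|m t - 1|)%:E)%E.
  by rewrite /Rintegral fineK//; exact: integrable_fin_num.
rewrite lee_fin RintegralZl//.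
apply: (@le_trans _ _ (M * (e / (M + 1)))); first by rewrite ler_wpM2l.
rewrite mulrA ler_pdivrMr ?ltr_wpDl// mulrC ler_wpM2l ?(ltW e0)//.
by rewrite lerDl.
Qed.

Unset Implicit Arguments.

Theorem theorem12 (R : realType) (a b A B : R) (L : R * R -> R)
    (ltab : a < b)
    (L_ge0 : forall p : R * R, 0 <= L p)
    (L_C1 : classC1 L)
    (L_convex : forall y : R,
      convex_function [set: R^o] (fun v : R^o => L (y, v))) :
  ereal_inf [set action L a b y | y in abs_cont a b `&` boundary a b A B] =
  ereal_inf [set action L a b y | y in lipschitz_fun a b `&` boundary a b A B].
Proof.
have Lc := classC1_continuous L_C1.
apply/eqP; rewrite eq_le; apply/andP; split.
  apply: ereal_inf_le_tmp => _ [y [ylip yAB] <-].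
  by exists y => //; split => //; exact: lipschitz_abs_cont.
apply: le_ereal_inf_tmp => _ [y [yac [ya yb]] <-].
apply/lee_addgt0Pr => e e0.
have [z [zlip za zb zy]] := lipschitz_approximation ltab Lc L_ge0 L_convex yac e0.
apply: le_trans zy; apply: ereal_inf_lbound; exists z => //.
by split => //; split; rewrite ?za ?zb.
Qed.
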